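(* Suppose there are constants $C,a,C_0>0$ such that the following two statements hold for every finite simple graph $G$ and every integer $m\ge 1$: (1) every $2$-modular witness $S\subseteq V(G)$ with $|S|\ge C_0 m$ contains a $4$-modular witness $S'\subseteq S$ with exactly $m$ vertices; (2) for every power of two $q=2^j$ with $q\ge 4$, every $q$-modular witness $S\subseteq V(G)$ with $|S|\ge C q^a m$ contains a $2q$-modular witness $S'\subseteq S$ with exactly $m$ vertices. Then there exists a constant $A$ such that $M(2^r,2^r)\le 2^{A(r+1)^2}$ for all $r\ge 1$. Consequently $F(n)/\log n\to\infty$ as $n\to\infty$.
   Context: All graphs are finite, simple, undirected. For $S\subseteq V(G)$, $G[S]$ is the induced subgraph and $\deg_S(v)$ is the degree of $v$ in $G[S]$. For an integer $q\ge1$, a set $U\subseteq V(G)$ is a $q$-modular witness ($q$-modular) if $\deg_U(u)\equiv\deg_U(v)\pmod q$ for all $u,v\in U$. $f(G)=\max\{|S|: G[S]\text{ is regular}\}$ and $F(n)=\min_{|V(G)|=n} f(G)$. For a power of two $q$ and integer $m\ge1$, $M(q,m)$ is the least $N$ such that every graph with at least $N$ vertices contains a $q$-modular witness of exactly $m$ vertices. *)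

(* Defs.v *)
From mathcomp Require Import all_boot.
From mathcomp Require Import boolp.

Set Implicit Arguments.
Unset Strict Implicit.
Unset Printing Implicit Defensive.

Record sgraph := SGraph {
  vertex :> finType;
  edge : rel vertex;
  edge_sym : symmetric edge;
  edge_irr : irreflexive edge }.

(* For v in S, this is the degree of v in the induced subgraph G[S]. *)
Definition deg (G : sgraph) (S : {set G}) (v : G) : nat :=
  #|[set u in S | edge v u]|.

Definition modular (q : nat) (G : sgraph) (U : {set G}) : Prop :=
  forall u v : G, u \in U -> v \in U -> deg U u = deg U v %[mod q].

Definition regular_induced (G : sgraph) (S : {set G}) : bool :=
  [forall u in S, forall v in S, deg S u == deg S v].

Definition f (G : sgraph) : nat :=
  \max_(S : {set G} | regular_induced S) #|S|.

Definition f_value (n k : nat) : Prop :=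
  exists G : sgraph, #|G| = n /\ f G = k.

Lemma f_value_ex (n : nat) : exists k, `[< f_value n k >].
Proof.
pose G := @SGraph 'I_n (fun _ _ => false) (fun _ _ => erefl) (fun _ => erefl).
by exists (f G); apply/asboolP; exists G; rewrite card_ord.
Qed.

Definition F (n : nat) : nat := ex_minn (f_value_ex n).

Definition forces_modular (q m N : nat) : Prop :=
  forall G : sgraph, N <= #|G| ->
    exists U : {set G}, modular q U /\ #|U| = m.

(* A threshold N exists for all q and m by Ramsey's theorem: cliques and
   independent sets are q-modular. *)
Lemma ramsey (G : sgraph) (n s t : nat) (A : {set G}) :
  s + t <= n -> 2 ^ n <= #|A| ->
  exists b (S : {set G}), [/\ S \subset A, #|S| = (if b then s else t) &
    {in S &, forall u v, u != v -> edge u v = b}].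
Proof.
elim: n s t A => [|n IHn] s t A.
  rewrite leqn0 addn_eq0 => /andP[/eqP-> /eqP->] _.
  exists true, set0; split; rewrite ?sub0set ?cards0 //.
  by move=> u v; rewrite inE.
case: s => [|s].
  move=> _ _; exists true, set0; split; rewrite ?sub0set ?cards0 //.
  by move=> u v; rewrite inE.
case: t => [|t].
  move=> _ _; exists false, set0; split; rewrite ?sub0set ?cards0 //.
  by move=> u v; rewrite inE.
move=> le_st leA.
have /card_gt0P[x xA] : 0 < #|A| by rewrite (leq_trans _ leA) ?expn_gt0.
pose B b := [set y in A | (y != x) && (edge x y == b)].
have extend b (S : {set G}) k : S \subset B b -> #|S| = k ->
    {in S &, forall u v, u != v -> edge u v = b} ->
    [/\ x |: S \subset A, #|x |: S| = k.+1 &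
        {in x |: S &, forall u v, u != v -> edge u v = b}].
  move=> /subsetP sSB cS hS; split.
  - apply/subsetP => y; rewrite !inE => /orP[/eqP-> //|/sSB].
    by rewrite inE => /andP[].
  - rewrite cardsU1 cS; case: (boolP (x \in S)) => // /sSB.
    by rewrite !inE eqxx andbF.
  - move=> u v; rewrite !inE => /orP[/eqP->|uS] /orP[/eqP->|vS].
    + by rewrite eqxx.
    + by move: (sSB _ vS); rewrite !inE => /and3P[_ _ /eqP].
    + by rewrite edge_sym; move: (sSB _ uS); rewrite !inE => /and3P[_ _ /eqP].
    + exact: hS.
have cB : #|A| = (#|B true| + #|B false|).+1.
  rewrite (cardsD1 x A) xA add1n -(cardsID [set y | edge x y] (A :\ x)).
  congr (_ + _).+1; apply: eq_card => y; rewrite !inE.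
    by case: (y == x); case: (y \in A); case: (edge x y).
  by case: (y == x); case: (y \in A); case: (edge x y).
have [leB|ltB] := leqP (2 ^ n) #|B true|.
  have [|b [S [sSB cS hS]]] := IHn s t.+1 (B true) _ leB.
    by rewrite -ltnS -addSn.
  case: b cS hS => cS hS.
    by exists true, (x |: S); apply: extend.
  exists false, S; split=> //; apply: (subset_trans sSB).
  by apply/subsetP => y; rewrite inE => /andP[].
have leB : 2 ^ n <= #|B false|.
  move: leA; rewrite cB expnS mul2n -addnn => leA.
  rewrite -(leq_add2l (2 ^ n)) (leq_trans leA) //.
  by rewrite -addSn leq_add2r.
have [|b [S [sSB cS hS]]] := IHn s.+1 t (B false) _ leB.
  by rewrite -ltnS -addnS.
case: b cS hS => cS hS; last by exists false, (x |: S); apply: extend.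
exists true, S; split=> //; apply: (subset_trans sSB).
by apply/subsetP => y; rewrite inE => /andP[].
Qed.

Lemma forces_modular_ex (q m : nat) : exists N, `[< forces_modular q m N >].
Proof.
exists (2 ^ (m + m)); apply/asboolP => G leG.
have [|b [U [_ cU hU]]] := @ramsey G (m + m) m m [set: G] (leqnn _).
  by rewrite cardsT.
have {}cU : #|U| = m by rewrite cU; case: b {cU hU}.
exists U; split=> // u v uU vU.
suff degE w : w \in U -> deg U w = (if b then #|U|.-1 else 0).
  by rewrite !degE.
move=> wU; rewrite /deg; case: b hU => hU.
  rewrite (cardsD1 w U) wU /=; apply: eq_card => y; rewrite !inE.
  case: eqVneq => [->|nyw]; first by rewrite edge_irr andbF.
  by case: (boolP (y \in U)) => // yU; rewrite hU // eq_sym.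
apply/eqP; rewrite cards_eq0; apply/eqP/setP => y; rewrite !inE.
apply/negbTE/negP => /andP[yU].
case: (eqVneq w y) => [->|nwy]; first by rewrite edge_irr.
by rewrite hU.
Qed.

Definition M (q m : nat) : nat := ex_minn (forces_modular_ex q m).

(* Main.v *)
Require Import Defs.
From mathcomp Require Import all_boot all_order all_algebra.
From mathcomp Require Import all_classical all_reals all_analysis.
From mathcomp Require Import zify.
Import numFieldNormedType.Exports.
Import Order.TTheory GRing.Theory Num.Theory.
Local Open Scope classical_set_scope.
Local Open Scope ring_scope.

(** By Gallai's theorem the vertices of any graph split into two sets inducing
    even degrees, so some 2-modular set contains at least half of the vertices.
    Iterating the lifting hypotheses from there loses a factor 2^(O(j)) at the
    j-th step, hence 2^(O(r^2)) in total before reaching modulus 2^r. A 2^r-modular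
    set with 2^r vertices is regular because its degrees are below 2^r; so
    F(n) >= 2^r as soon as n >= 2^(B(r+1)^2), and 2^sqrt(log n / B) outgrows
    log n. *)

Local Open Scope nat_scope.

(** By duality it suffices that the diagonal annihilates the kernel of [B], which is tested on the
    columns of [cokermx B]. The hypothesis [x * x = x] stands for being F_2. *)
Lemma sym_diag_submx (K : fieldType) n (B : 'M[K]_n) :
  (forall x : K, x * x = x)%R -> B^T%R = B ->
  ((\row_i B i i)%R <= B)%MS.
Proof.
move=> idem symB.
have char2 : (2%:R = 0 :> K)%R.
  by have /eqP := idem 2%:R%R; rewrite -natrM (natrD _ 2 2) -subr_eq0 addrK => /eqP.
have symE i j : B i j = B j i by rewrite -{1}symB mxE.
(* v^T B v reduces to its diagonal part in characteristic 2. *)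
have quad (v : 'cV_n) : (B *m v = 0 -> \sum_i B i i * v i 0 = 0)%R.
  move=> Bv; have : (\sum_i v i 0 * (B *m v) i 0 = 0)%R.
    by rewrite Bv big1 // => i _; rewrite mxE mulr0.
  under eq_bigr do rewrite mxE big_distrr /=.
  rewrite pair_big /= (bigID (fun p => p.1 == p.2)) /=.
  rewrite [X in (_ + X)%R](_ : _ = 0)%R.
    rewrite addr0 (reindex (fun i => (i, i))) /=; last first.
      by exists fst => [i _ //|[i j]]; rewrite inE /= => /eqP->.
    move=> diag0; rewrite -[RHS]diag0; apply: eq_big => [i|i _]; first by rewrite eqxx.
    by rewrite mulrCA idem.
  (* By symmetry the terms at [(i, j)] and [(j, i)] agree, so the off-diagonal sum is twice its part
     above the diagonal. *)
  rewrite (bigID (fun p : 'I_n * 'I_n => p.1 < p.2)) /=.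
  rewrite [X in (_ + X)%R](reindex (fun p => (p.2, p.1))) /=; last first.
    by exists (fun p => (p.2, p.1)) => [[]|[]].
  rewrite [X in (_ + X)%R](_ : _ = \sum_(p : 'I_n * 'I_n | (p.1 != p.2) && (p.1 < p.2)%N)
      (v p.1 0 * (B p.1 p.2 * v p.2 0)))%R.
    by rewrite -mulr2n -mulr_natl char2 mul0r.
  apply: eq_big => [[i j]|[i j] _] /=; last by rewrite symE [LHS]mulrC mulrAC [LHS]mulrC.
  by rewrite -leqNgt -!(inj_eq val_inj) /=; case: ltngtP.
rewrite submxE; apply/eqP/rowP => k.
have {quad} := quad (col k (cokermx B)).
rewrite colE mulmxA mulmx_coker mul0mx -colE => /(_ erefl) quad.
by rewrite [LHS]mxE [RHS]mxE -[RHS]quad; apply: eq_bigr => i _; rewrite mxE [in RHS]mxE.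
Qed.

Lemma F2_idem (x : 'F_2) : (x * x = x)%R.
Proof. by case: x => -[|[|//]] i; apply/val_inj. Qed.

Lemma F2_nat_even (n : nat) : (n%:R = 0 :> 'F_2)%R -> ~~ odd n.
Proof. by move/(congr1 val); rewrite /= val_Fp_nat //= modn2; case: odd. Qed.

Lemma degE (G : sgraph) (S : {set G}) (v : G) :
  deg S v = \sum_(u in S) edge v u.
Proof.
rewrite /deg -sum1_card [RHS](bigID (edge v)) /= [X in _ + X]big1 ?addn0.
  by apply: eq_big => [u|u]; rewrite !inE => // /andP[_ ->].
by move=> u /andP[_ /negbTE->].
Qed.

Lemma deg_setC (G : sgraph) (S : {set G}) (v : G) :
  deg [set: G]%SET v = deg S v + deg (~: S) v.
Proof.
by rewrite !degE (bigID (mem S)) /=; congr (_ + _); apply: eq_bigl => u; rewrite !inE.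
Qed.

(* The indicator x of S solves (Adj + diag(deg)) x = deg over F_2. *)
Lemma gallai_even_partition (G : sgraph) :
  exists S : {set G}, {in S, forall v, ~~ odd (deg S v)} /\
                      {in ~: S, forall v, ~~ odd (deg (~: S) v)}.
Proof.
pose w := @enum_val G predT.
pose B : 'M['F_2]_#|G| :=
  (\matrix_(i, j) (edge (w i) (w j) + (i == j) * deg [set: G]%SET (w i))%N%:R)%R.
have symB : B^T%R = B.
  apply/matrixP => i j; rewrite !mxE edge_sym eq_sym.
  by case: eqVneq => [->|].
(* A graph has no loops, so the diagonal of [B] is the degree vector mod 2. *)
have /submxP[x xE] := sym_diag_submx _ _ _ F2_idem symB.
pose S := [set v : G | x 0%R (enum_rank v) != 0%R]%SET.
have x01 v : x 0%R (enum_rank v) = ((v \in S)%:R)%R.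
  rewrite inE; case: (x _ _) => -[|[|//]] i; exact/val_inj.
have key v : ((deg [set: G]%SET v)%:R = (deg S v + (v \in S) * deg [set: G]%SET v)%:R :> 'F_2)%R.
  move/matrixP/(_ 0%R (enum_rank v)): xE; rewrite !mxE /w enum_rankK edge_irr eqxx mul1n add0n => ->.
  rewrite (reindex enum_rank) /=; last by apply: onW_bij; exact: enum_rank_bij.
  under eq_bigr do rewrite x01 mxE /w !enum_rankK natrD mulrDr (inj_eq enum_rank_inj).
  rewrite big_split /= natrD; congr (_ + _)%R.
    rewrite degE natr_sum [RHS]big_mkcond /=; apply: eq_bigr => u _.
    by rewrite edge_sym; case: (u \in S); rewrite ?mul1r ?mul0r.
  rewrite (bigD1 v) //= eqxx mul1n -natrM big1 ?addr0 // => u /negbTE ->.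
  by rewrite mul0n mulr0.
(* For [v] in [S] the full degree cancels in [key], leaving [deg S v] even; for [v] outside, the
   full degree agrees with [deg S v] mod 2, so the degree into [~: S] is even. *)
exists S; split=> v vS; apply: F2_nat_even; move: (key v).
  by rewrite vS mul1n natrD => eqT; apply: (addIr (deg [set: G]%SET v)%:R%R); rewrite add0r -eqT.
rewrite inE in vS; rewrite (negbTE vS) mul0n addn0 (deg_setC _ S) natrD => eqS.
by apply: (addrI (deg S v)%:R%R); rewrite addr0.
Qed.

Lemma even_modular2 (G : sgraph) (S : {set G}) :
  {in S, forall v, ~~ odd (deg S v)} -> modular 2 S.
Proof. by move=> evS u v uS vS; rewrite !modn2 !(negbTE (evS _ _)). Qed.

Lemma exists_large_modular2 (G : sgraph) :
  exists S : {set G}, modular 2 S /\ #|G| <= 2 * #|S|.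
Proof.
have [S [evS evC]] := gallai_even_partition G.
have cG : #|G| = #|S| + #|~: S| by rewrite cardsC.
have [le|/ltnW le] := leqP #|~: S| #|S|.
  by exists S; split; [exact: even_modular2|rewrite cG mul2n -addnn leq_add2l].
by exists (~: S); split; [exact: even_modular2|rewrite cG mul2n -addnn leq_add2r].
Qed.

Lemma modular_dvd (q d : nat) (G : sgraph) (U : {set G}) :
  d %| q -> modular q U -> modular d U.
Proof.
move=> dq mU u v uU vU.
by rewrite -(modn_dvdm (deg U u) dq) (mU _ _ uU vU) modn_dvdm.
Qed.

Lemma deg_lt_card (G : sgraph) (U : {set G}) (u : G) : u \in U -> deg U u < #|U|.
Proof.
move=> uU; apply: proper_card; apply/properP; split.
  by apply/fintype.subsetP => v; rewrite inE => /andP[].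
by exists u => //; rewrite inE edge_irr andbF.
Qed.

Lemma modular_card_regular (G : sgraph) (U : {set G}) :
  modular #|U| U -> regular_induced U.
Proof.
move=> mU; apply/forall_inP => u uU; apply/forall_inP => v vU.
by move: (mU _ _ uU vU); rewrite !modn_small ?deg_lt_card // => ->.
Qed.

Lemma forces_modular_F (q n : nat) : forces_modular q q n -> q <= F n.
Proof.
move=> force; rewrite /F; case: ex_minnP => k /asboolP[G [cG <-]] _.
have [U [mU cU]] := force G (eq_leq (esym cG)); rewrite -[q in q <= _]cU.
by apply: leq_bigmax_cond; apply: modular_card_regular; rewrite cU.
Qed.

Lemma forces_modularW (q m N N' : nat) :
  N <= N' -> forces_modular q m N -> forces_modular q m N'.
Proof. by move=> leN force G leG; apply: force; apply: leq_trans leG. Qed.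

Lemma M_le (q m N : nat) : forces_modular q m N -> M q m <= N.
Proof. by move=> force; rewrite /M; case: ex_minnP => k _; apply; apply/asboolP. Qed.

(** Each induction step asks the previous modulus for a set larger by the factor lost in the lift.
    The exponent lost is linear in the level, hence absorbed by the increment of a multiple of its
    square. The base case pays a factor 2 for Gallai and [2 ^ c] for [lift2]. *)
Lemma iterate_lift (b c : nat) :
  (forall (G : sgraph) (m : nat), 1 <= m -> forall S : {set G}, modular 2 S ->
     2 ^ c * m <= #|S| ->
     exists S' : {set G}, [/\ S' \subset S, modular 4 S' & #|S'| = m]) ->
  (forall (G : sgraph) (m : nat), 1 <= m -> forall j, 4 <= 2 ^ j ->
     forall S : {set G}, modular (2 ^ j) S -> 2 ^ (c + j * b) * m <= #|S| ->
     exists S' : {set G}, [/\ S' \subset S, modular (2 * 2 ^ j) S' & #|S'| = m]) ->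
  forall r m, 1 <= m ->
    forces_modular (2 ^ r.+2) m (2 ^ ((b + c + 1) * r.+2 ^ 2) * m).
Proof.
move=> lift2 lift; elim=> [|r IHr] m m_gt0 G leG.
  have [S [mS leS]] := exists_large_modular2 G.
  have [|S' [_ mS' cS']] := lift2 G m m_gt0 S mS; last by exists S'.
  rewrite -(leq_pmul2l (ltn0Sn 1)) mulnA -expnS (leq_trans _ leS) // (leq_trans _ leG) //.
  by rewrite leq_pmul2r // leq_exp2l //; nia.
have [||S [mS cS]] := IHr (2 ^ (c + r.+2 * b) * m) _ G.
- by rewrite muln_gt0 expn_gt0.
- rewrite (leq_trans _ leG) // mulnA -expnD leq_pmul2r // leq_exp2l //; nia.
have [||S' [_ mS' cS']] := lift G m m_gt0 r.+2 _ S mS.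
- by rewrite -[4]/(2 ^ 2) leq_exp2l.
- by rewrite cS.
by exists S'; rewrite expnS.
Qed.

Lemma cube_le_exp2 (r : nat) : (r + 2) ^ 3 <= 64 * 2 ^ r.
Proof.
(* Passing from [r] to [r + 1] at most doubles the cube only from [r = 2] on; smaller cases are
   computed. *)
elim: r => [|[|[|r]] IHr] //; rewrite [2 ^ r.+3]expnS mulnCA.
by apply: leq_trans (leq_mul (leqnn 2) IHr); nia.
Qed.

(** Take the largest [r] with [B * (r + 1) ^ 2 <= L], where [L] is the integer binary logarithm of
    [n]. Maximality gives [L < B * (r + 2) ^ 2], and [K * B * (r + 2) ^ 2 <= 2 ^ r] for large
    [r]. *)
Lemma superlog_of_exp_sqrt (B : nat) (g : nat -> nat) : 0 < B ->
  (forall r n, 1 <= r -> 2 ^ (B * (r + 1) ^ 2) <= n -> 2 ^ r <= g n) ->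
  forall K, exists N, forall n, N <= n -> K * (trunc_log 2 n).+1 <= g n.
Proof.
(* The 64 matches [cube_le_exp2]; the [+ 1] keeps [r0] positive when [K = 0]. *)
move=> B_gt0 gP K; pose r0 := 64 * K * B + 1.
exists (2 ^ (B * (r0 + 1) ^ 2)) => n leN.
have n_gt0 : 0 < n by apply: leq_trans leN; rewrite expn_gt0.
set L := trunc_log 2 n.
have P0 : B * (r0 + 1) ^ 2 <= L by exact: trunc_log_max.
have ub r : B * (r + 1) ^ 2 <= L -> r <= L by nia.
case: (ex_maxnP (ex_intro (fun r => B * (r + 1) ^ 2 <= L) r0 P0) ub) => r Pr maxr.
have le_r : r0 <= r by exact: maxr.
have ltL : L < B * (r + 2) ^ 2.
  rewrite ltnNge; apply/negP => le; have := maxr r.+1.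
  by rewrite addSnnS => /(_ le); rewrite ltnn.
have r_gt0 : 0 < r by apply: leq_trans le_r; rewrite /r0 addn1.
apply: (leq_trans _ (gP r n r_gt0 _)); last first.
  by apply: leq_trans (trunc_logP (isT : 1 < 2) n_gt0); rewrite leq_exp2l.
apply: (leq_trans (leq_mul (leqnn K) ltL)).
rewrite -(leq_pmul2l (isT : 0 < 64)) (leq_trans _ (cube_le_exp2 r)) //.
rewrite (expnS (r + 2) 2); move: ((r + 2) ^ 2) => X.
by rewrite !mulnA leq_mul // (leq_trans _ (leq_addr 2 r)) // (leq_trans _ le_r) // leq_addr.
Qed.

Local Open Scope ring_scope.

(** Since [ln 2 <= 1], integer binary logarithms bound [ln] from above, which transfers the
    natural-number growth estimate to the reals. *)
Lemma ln_le_trunc_log (R : realType) (n : nat) :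
  (0 < n)%N -> ln (n%:R : R) <= (trunc_log 2 n).+1%:R.
Proof.
move=> n_gt0; have ln2 : ln (2 : R) <= 1.
  by rewrite -[2]/(1 + 1) le_ln1Dx // ltrN10.
have le_n : n%:R <= (2 : R) ^+ (trunc_log 2 n).+1.
  by rewrite -natrX ler_nat ltnW // trunc_log_ltn.
apply: (@le_trans _ _ (ln ((2 : R) ^+ (trunc_log 2 n).+1))).
  by rewrite ler_ln // posrE ?ltr0n // exprn_gt0.
by rewrite lnXn // -[leRHS]mulr1 mulr_natl lerMn2r ln2 orbT.
Qed.

Lemma le_exp2_bound (R : realType) (x : R) (k : nat) :
  0 <= x -> (Num.bound x <= k)%N -> x <= (2 ^ k)%N%:R.
Proof.
move=> x_ge0 le_k; apply: le_trans (ltW (archi_boundP x_ge0)) _.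
by rewrite ler_nat (leq_trans le_k) // ltnW // ltn_expl.
Qed.

Theorem mainTheorem1 (R : realType) (C a C0 : R)
  (C_gt0 : 0 < C) (a_gt0 : 0 < a) (C0_gt0 : 0 < C0)
  (lift2 : forall (G : sgraph) (m : nat), (1 <= m)%N ->
     forall S : {set G}, modular 2 S -> C0 * m%:R <= #|S|%:R ->
     exists S' : {set G}, [/\ S' \subset S, modular 4 S' & #|S'| = m])
  (lift : forall (G : sgraph) (m : nat), (1 <= m)%N ->
     forall j : nat, (4 <= 2 ^ j)%N ->
     forall S : {set G}, modular (2 ^ j) S ->
     C * (2 ^ j)%N%:R `^ a * m%:R <= #|S|%:R ->
     exists S' : {set G},
       [/\ S' \subset S, modular (2 * 2 ^ j) S' & #|S'| = m]) :
  (exists A : R, forall r : nat, (1 <= r)%N ->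
     (M (2 ^ r) (2 ^ r))%:R <= 2 `^ (A * (r + 1)%N%:R ^+ 2)) /\
  ((F n)%:R / ln (n%:R : R) @[n --> \oo] --> +oo).

Proof.
pose c := (Num.bound C + Num.bound C0)%N; pose b := Num.bound a.
have leC : C <= (2 ^ c)%N%:R by rewrite le_exp2_bound ?ltW // leq_addr.
have leC0 : C0 <= (2 ^ c)%N%:R by rewrite le_exp2_bound ?ltW // leq_addl.
(* One more than the constant of [iterate_lift], to pay for the factor [m = 2 ^ r]. *)
pose B := (b + c + 2)%N.
have force r : (1 <= r)%N ->
    forces_modular (2 ^ r) (2 ^ r) (2 ^ (B * (r + 1) ^ 2)).
  case: r => // r _ G leG.
  (* The iteration starts at modulus 4, so it is run one level too high and the modulus is halved
     afterwards; this also covers modulus 2. *)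
  have [||||U [mU cU]] := @iterate_lift b c _ _ r (2 ^ r.+1)%N _ G.
  - move=> G' m m_gt0 S mS leS; apply: lift2 => //.
    by rewrite (le_trans (ler_wpM2r _ leC0)) // -natrM ler_nat.
  - move=> G' m m_gt0 j j_ge2 S mS leS; apply: lift => //.
    apply: (@le_trans _ _ (2 ^ (c + j * b) * m)%N%:R); last by rewrite ler_nat.
    rewrite natrM ler_wpM2r // expnD natrM ler_pM ?powR_ge0 ?(ltW C_gt0) //.
    (* The base [2 ^ j] is at least 1, so the real exponent [a] may be raised to the integer [b]. *)
    rewrite expnM [leRHS]natrX -powR_mulrn // ler_powR ?ler1n ?expn_gt0 //.
    exact/ltW/archi_boundP/ltW.
  - by rewrite expn_gt0.
  - apply: leq_trans leG; rewrite -expnD leq_exp2l // /B; nia.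
  by exists U; split=> //; apply: modular_dvd mU; rewrite dvdn_exp2l.
split.
  exists B%:R => r r_ge1; rewrite -natrX -natrM powR_mulrn // -natrX ler_nat.
  exact: M_le (force r r_ge1).
apply/cvgryPge => K.
(* [K] may be negative, so a natural number above its absolute value is used. *)
have [||N NP] := @superlog_of_exp_sqrt B F _ _ (Num.bound `|K|).
- by rewrite /B addn2.
- by move=> r n r_ge1 len; apply/forces_modular_F/(forces_modularW _ _ _ _ len)/force.
(* From [n = 2] on, [ln n] is positive and can be cleared from the denominator. *)
exists (maxn N 2) => // n /=; rewrite geq_max => /andP[leN n_ge2].
have n_gt0 : (0 < n)%N by exact: ltnW.
rewrite ler_pdivlMr; last by rewrite ln_gt0 // ltr1n.
apply: (@le_trans _ _ ((Num.bound `|K|)%:R * (trunc_log 2 n).+1%:R)).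
  apply: le_trans (ler_wpM2l _ (ln_le_trunc_log R n n_gt0)) => //.
  rewrite ler_wpM2r ?ln_ge0 ?ler1n // (le_trans (ler_norm K)) //.
  exact/ltW/archi_boundP.
by rewrite -natrM ler_nat NP.
Qed.
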